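(* Consider complex black-box rounded arithmetic with operations $q_{-2},q_{-1},q_0$, multiplication by complex constants $q^c(z)=c\cdot z$, and $\{q_j:j\in J\}$, where each $q_j$, $j\in J$, is an irreducible polynomial. If $p:\mathbb C^n\to\mathbb C$ is a polynomial such that $V(p)$ is a finite union of intersections of hyperplanes $Z_i=\{x:x_i=0\}$, $S_{ij}=\{x:x_i+x_j=0\}$, $D_{ij}=\{x:x_i-x_j=0\}$, and varieties $V(q_j)$ for $j\in J$, then $p$ is accurately evaluable on $\mathbb C^n$.
   Context: **Black-box rounded arithmetic.** A black-box operation takes finitely many complex inputs and has as exact output a polynomial in its inputs. Here $q_{-2}(z_1,z_2)=z_1z_2$, $q_{-1}(z_1,z_2)=z_1+z_2$, $q_0(z_1,z_2)=z_1-z_2$; $J$ may be infinite; $q^c$ is available for every complex constant $c$. An algorithm receives its input $x\in\mathbb C^n$ exactly and is a finite directed acyclic graph with sources carrying the variables $x_i$, computational nodes, possibly branching nodes (exact equality tests of intermediate quantities), and one output node per branch. Each computational node applies one of the available operations to inputs that are sources or outputs of other computational nodes (possibly repeated, each possibly negated exactly) and multiplies the exact result by $(1+\delta_i)$, where $\delta_i$ is a complex error variable specific to that node, arbitrary subject to $|\delta_i|\le\epsilon$. The output is $p_{comp}(x,\delta)$; an algorithm for $p$ satisfies $p_{comp}(x,0)=p(x)$. It is accurate on $\mathcal D$ if for every $0<\eta<1$ there is $0<\epsilon<1$ such that $|p_{comp}(x,\delta)-p(x)|\le\eta|p(x)|$ for all $x\in\mathcal D$ and all $\delta$ with $|\delta_i|\le\epsilon$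 for all $i$. $p$ is accurately evaluable on $\mathcal D$ if some algorithm is accurate for $p$ on $\mathcal D$. $V(p)=\{x\in\mathbb C^n:p(x)=0\}$. $V(q_j)\subseteq\mathbb C^n$ is the zero set of $q_j$, its arguments being identified with distinct coordinates among $x_1,\dots,x_n$. *)

(* Defs.v *)
From mathcomp Require Import all_boot all_order all_algebra.
From mathcomp Require Import classical_sets reals.
From mathcomp Require Import complex.
From mathcomp Require Import mpoly.

Set Implicit Arguments.
Unset Strict Implicit.
Unset Printing Implicit Defensive.

Import Order.TTheory GRing.Theory Num.Theory.
Local Open Scope ring_scope.
Local Open Scope complex_scope.
Local Open Scope classical_set_scope.

(* The units of {mpoly F[k]} over a field F are the nonzero constants. *)
Definition mpoly_irreducible (F : fieldType) (k : nat) (f : {mpoly F[k]}) : Prop :=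
  [/\ f != 0, f \isn't a GRing.unit &
      forall g h : {mpoly F[k]}, f = g * h ->
        g \is a GRing.unit \/ h \is a GRing.unit].

Section BlackBoxArithmetic.

Variables (R : realType) (J : Type) (ar : J -> nat).
Variable q : forall j : J, {mpoly R[i][ar j]}.

Inductive operation : Type :=
  | OpMul | OpAdd | OpSub
  | OpScale of R[i]
  | OpBox of J.

Definition op_arity (o : operation) : nat :=
  match o with
  | OpMul | OpAdd | OpSub => 2
  | OpScale _ => 1
  | OpBox j => ar j
  end.

Definition op_poly (o : operation) : {mpoly R[i][op_arity o]} :=
  match o return {mpoly R[i][op_arity o]} with
  | OpMul => 'X_ord0 * 'X_ord_max
  | OpAdd => 'X_ord0 + 'X_ord_max
  | OpSub => 'X_ord0 - 'X_ord_max
  | OpScale c => c *: 'X_ord0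
  | OpBox j => q j
  end.

(* [algorithm m] is an algorithm that may refer to m available quantities: the
   sources and the computational nodes met so far, in topological order.  The
   graph is unfolded into a tree at its branching nodes; along a branch,
   quantities can be used any number of times.  In [Compute o args k] the
   boolean of an argument tells whether it is (exactly) negated, and the new
   quantity has index [ord_max] in [k].  [Branch r s a b] continues with [a] if
   quantities r and s are equal, and with [b] otherwise. *)
Inductive algorithm : nat -> Type :=
  | Output m of 'I_m : algorithm m
  | Compute m (o : operation) of ('I_(op_arity o) -> bool * 'I_m)
      & algorithm m.+1 : algorithm m
  | Branch m of 'I_m & 'I_m & algorithm m & algorithm m : algorithm m.

Fixpoint node (m : nat) (a : algorithm m) : Type :=
  match a with
  | Output _ _ => void
  | Compute _ _ _ k => option (node k)
  | Branch _ _ _ a1 a2 => (node a1 + node a2)%type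
  end.

Definition push (m : nat) (v : 'I_m -> R[i]) (z : R[i]) : 'I_m.+1 -> R[i] :=
  fun i => if unlift ord_max i is Some i' then v i' else z.

Definition arg_value (m : nat) (v : 'I_m -> R[i]) (u : bool * 'I_m) : R[i] :=
  if u.1 then - v u.2 else v u.2.

Fixpoint p_comp (m : nat) (a : algorithm m) :
    ('I_m -> R[i]) -> (node a -> R[i]) -> R[i] :=
  match a in algorithm m return ('I_m -> R[i]) -> (node a -> R[i]) -> R[i] with
  | Output _ r => fun v _ => v r
  | Compute _ o args k => fun v delta =>
      let exact := (op_poly o).@[fun t => arg_value v (args t)] in
      p_comp (push v (exact * (1 + delta None))) (fun d => delta (Some d))
  | Branch _ r s a1 a2 => fun v delta =>
      if v r == v s then p_comp v (fun d => delta (inl d))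
      else p_comp v (fun d => delta (inr d))
  end.

Variable n : nat.

Definition algorithm_for (a : algorithm n) (p : {mpoly R[i][n]}) : Prop :=
  forall x : 'I_n -> R[i], p_comp x (fun _ : node a => 0) = p.@[x].

Definition accurate_on (a : algorithm n) (p : {mpoly R[i][n]})
    (D : set ('I_n -> R[i])) : Prop :=
  forall eta : R, 0 < eta < 1 ->
  exists2 eps : R, 0 < eps < 1 &
    forall (x : 'I_n -> R[i]) (delta : node a -> R[i]),
      D x -> (forall d : node a, `|delta d| <= eps%:C) ->
      `|p_comp x delta - p.@[x]| <= eta%:C * `|p.@[x]|.

Definition accurately_evaluable (p : {mpoly R[i][n]})
    (D : set ('I_n -> R[i])) : Prop :=
  exists a : algorithm n, algorithm_for a p /\ accurate_on a p D.

Definition zero_set (p : {mpoly R[i][n]}) : set ('I_n -> R[i]) :=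
  [set x | p.@[x] = 0].

(* V(q_j) is taken for every identification sigma of the arguments of q_j with
   distinct coordinates. *)
Inductive basic_variety : set ('I_n -> R[i]) -> Prop :=
  | basic_Z (i : 'I_n) : basic_variety [set x | x i = 0]
  | basic_S (i j : 'I_n) of i != j : basic_variety [set x | x i + x j = 0]
  | basic_D (i j : 'I_n) of i != j : basic_variety [set x | x i - x j = 0]
  | basic_V (j : J) (sigma : 'I_(ar j) -> 'I_n) of injective sigma :
      basic_variety [set x | (q j).@[fun t => x (sigma t)] = 0].

(* The intersections may be infinite, or empty (giving the whole space, which
   is V(0)), but the union has at least one member.  With an empty union V(p)
   would be empty and p a nonzero constant, which no algorithm computes if all
   the q_j vanish at the origin, since then so does every computed quantity. *)
Definition finite_union_of_intersections (A : set ('I_n -> R[i])) : Prop :=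
  exists (N : nat) (F : 'I_N -> set (set ('I_n -> R[i]))),
    [/\ (0 < N)%N,
        forall k, F k `<=` basic_variety &
        A = \bigcup_k \bigcap_(W in F k) W].

End BlackBoxArithmetic.

(* Main.v *)
Require Import Defs.
From HB Require Import structures.
From mathcomp Require Import all_boot all_order all_algebra.
From mathcomp Require Import boolp classical_sets reals.
From mathcomp Require Import complex.
From mathcomp Require Import mpoly ring zify.

(** Every basic variety is the zero set of an irreducible polynomial [w] that a
    single rounded operation evaluates at the sources
    ([basic_variety_one_op]).  Suppose that [p] is nonzero.  Then none of the
    intersections is the whole space, so each lies in some basic variety, and the
    zero set of [p] is covered by the zero sets of finitely many such [w].

    By the Nullstellensatz every irreducible factor of [p] divides the product of
    the chosen [w], hence is associate to one of them.  Therefore [p] is a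
    constant times a product of polynomials [w] ([prod_of_zero_set]).  Computing
    these factors and multiplying them only involves products, so the relative
    errors multiply: the result is [p] times finitely many factors [1 + d], with
    no cancellation ([product_algorithm], [computes_evaluable]).

    The product is empty when [p] is a nonzero constant.  Then the intersections
    are empty; as the sets [x_i = 0] and [x_i = x_j] and [x_i = - x_j] contain the
    origin, some black box does not vanish there and supplies the constant
    ([constant_evaluable]).  The zero polynomial is 0 times a coordinate.

    The algebra needed is unique factorization in several variables, by induction
    on their number with Gauss's lemma ([gauss_prime], [mpoly_factorial]), and the
    Nullstellensatz for one irreducible equation
    ([nullstellensatz_irreducible]).  Both rest on the same elimination: an
    irreducible [f] of positive degree in the last variable that does not divide
    [g] satisfies [u f + v g = d] with [d] nonzero and free of that variable
    ([irreducible_bezout]).  That identifying arguments with coordinates keeps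
    a black box irreducible is [irreducible_rename]. *)

Set Implicit Arguments.
Unset Strict Implicit.
Unset Printing Implicit Defensive.

Import Order.TTheory GRing.Theory Num.Theory.
Local Open Scope ring_scope.

(** * Divisibility in integral domains *)

Section Divisibility.

Variable A : idomainType.
Implicit Types a b c f g m p s u : A.

Definition divides a b : Prop := exists c, b = c * a.

Definition irreducible_elt p : Prop :=
  [/\ p != 0, p \isn't a GRing.unit &
      forall g h, p = g * h -> g \is a GRing.unit \/ h \is a GRing.unit].

Definition prime_elt p : Prop :=
  [/\ p != 0, p \isn't a GRing.unit &
      forall a b, divides p (a * b) -> divides p a \/ divides p b].

Definition prime_factored c : Prop :=
  exists (u : A) (ps : seq A),
    [/\ u \is a GRing.unit, forall p, p \in ps -> prime_elt p
      & c = u * \prod_(p <- ps) p].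

Lemma prime_eltM_unit p u :
  prime_elt p -> u \is a GRing.unit -> prime_elt (u * p).
Proof.
case=> p0 pU pP uU; split.
    by rewrite mulf_neq0 //; apply: contraTneq uU => ->; rewrite unitr0.
  by rewrite unitrM uU.
have div_up b : divides p b -> divides (u * p) b.
  by case=> c ->; exists (c * u^-1); rewrite mulrA divrK.
move=> a b [c abE].
have /pP[/div_up|/div_up] : divides p (a * b); [|by left|by right].
by exists (c * u); rewrite abE mulrA.
Qed.

Lemma prime_dvd_prod p (ws : seq A) :
  prime_elt p -> divides p (\prod_(w <- ws) w) ->
  exists2 w, w \in ws & divides p w.
Proof.
move=> [p0 pU pP]; elim: ws => [|w ws IH].
  rewrite big_nil => -[c c1]; case/negP: pU.
  by apply/unitrP; exists c; rewrite -c1 mulrC -c1.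
rewrite big_cons => /pP[pw|/IH[w' w'in pw']]; first by exists w; rewrite ?mem_head.
by exists w' => //; rewrite in_cons w'in orbT.
Qed.

(** Each prime factor of [c] divides [m] or [s] and can be cancelled there.
    This stands in for the passage to a fraction field: an identity known up to
    a factor [c] yields one without it. *)
Lemma cancel_primes c f m s : prime_factored c -> c * f = m * s ->
  exists c1 c2 m' s', [/\ c = c1 * c2, m = c1 * m', s = c2 * s' & f = m' * s'].
Proof.
case=> u [ps [uU]]; elim: ps c m s => [|p ps IH] c m s psP ->.
  rewrite big_nil mulr1 => ufE; exists u, 1, (u^-1 * m), s.
  by rewrite mulr1 mul1r mulVKr // -mulrA -ufE mulKr.
rewrite big_cons mulrCA; set c0 := u * _ => cfE.
have [p0 _ pP] := psP p (mem_head _ _).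
have psP' p' : p' \in ps -> prime_elt p' by move=> p'in; apply: psP; rewrite in_cons p'in orbT.
have [[m0 mE]|[s0 sE]] : divides p m \/ divides p s.
- by apply: pP; exists (c0 * f); rewrite -cfE; ring.
- have /(IH _ _ _ psP' erefl)[c1 [c2 [m' [s' [cE m0E -> ->]]]]] : c0 * f = m0 * s.
    by apply: (mulfI p0); rewrite mulrA cfE mE mulrCA mulrA.
  exists (p * c1), c2, m', s'; split=> //; first by rewrite /c0 cE mulrA.
  by rewrite mE m0E; ring.
- have /(IH _ _ _ psP' erefl)[c1 [c2 [m' [s' [cE -> s0E ->]]]]] : c0 * f = m * s0.
    by apply: (mulfI p0); rewrite mulrA cfE sE [RHS]mulrC mulrA.
  exists c1, (p * c2), m', s'; split=> //; first by rewrite /c0 cE; ring.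
  by rewrite sE s0E; ring.
Qed.

Lemma irreducible_prime p : prime_factored p -> irreducible_elt p -> prime_elt p.
Proof.
case=> u [[|p1 ps] [uU psP ->]] [p0 pU pI].
  by rewrite big_nil mulr1 uU in pU.
have p1P := psP _ (mem_head _ _).
move: pI; rewrite big_cons mulrCA => /(_ _ _ erefl)[|cU].
  by case: p1P => _ /negP.
by rewrite mulrC; apply: prime_eltM_unit.
Qed.

End Divisibility.

(** * Gauss's lemma *)

Section Gauss.

Variable A : idomainType.
Implicit Types f g h m s : {poly A}.

Lemma polyC_unitE (c : A) : (c%:P \is a GRing.unit) = (c \is a GRing.unit).
Proof.
rewrite poly_unitE coefC eqxx size_polyC.
by case: (eqVneq c 0) => [->|_]; rewrite ?unitr0.
Qed.

Lemma irreducible_polyC_inv (c : A) : irreducible_elt c%:P -> irreducible_elt c.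
Proof.
case; rewrite polyC_eq0 polyC_unitE => c0 cU cI; split=> // a b abE.
by rewrite -!polyC_unitE; apply: cI; rewrite abE polyCM.
Qed.

(** The quotient of [{poly A}] by [p] is a domain because leading coefficients
    multiply: if [p] divides [g * h] it divides one of the two leading
    coefficients, and the corresponding leading term can be removed. *)
Lemma prime_polyC (p : A) : prime_elt p -> prime_elt p%:P.
Proof.
case=> p0 pU pP; split; rewrite ?polyC_eq0 ?polyC_unitE // => g h.
have [k] := ubnP (size g + size h)%N; elim: k g h => // k IH g h szgh [c ghE].
have [->|g0] := eqVneq g 0; first by left; exists 0; rewrite mul0r.
have [->|h0] := eqVneq h 0; first by right; exists 0; rewrite mul0r.
have dvdBlead f a : lead_coef f = a * p ->
  f - (lead_coef f)%:P * 'X^((size f).-1) =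
  f - a%:P * 'X^((size f).-1) * p%:P.
  by move=> ->; rewrite polyCM mulrAC.
have size_lead f : f != 0 ->
    (size (f - (lead_coef f)%:P * 'X^((size f).-1))%R < size f)%N.
  move=> f0; rewrite -(prednK (n := size f)) ?size_poly_gt0 //= ltnS.
  apply/leq_sizeP => j; rewrite coefB coefCM coefXn leq_eqVlt => /orP[/eqP<-|lt_j].
    by rewrite eqxx mulr1 subrr.
  rewrite gtn_eqF // mulr0 subr0 nth_default //.
  by rewrite -(prednK (n := size f)) ?size_poly_gt0.
have : divides p (lead_coef g * lead_coef h).
  by exists (lead_coef c); rewrite -lead_coefM ghE lead_coefM lead_coefC.
case/pP => -[a aE].
- have := IH (g - (lead_coef g)%:P * 'X^((size g).-1)) h.
  rewrite (dvdBlead _ _ aE); case.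
  + by rewrite -(dvdBlead _ _ aE) -ltnS (leq_trans _ szgh) // ltnS ltn_add2r size_lead.
  + exists (c - a%:P * 'X^((size g).-1) * h).
    by rewrite mulrBl ghE mulrBl mulrAC.
  + case=> d dE; left; exists (d + a%:P * 'X^((size g).-1)).
    by rewrite mulrDl -dE subrK.
  + by right.
- have := IH g (h - (lead_coef h)%:P * 'X^((size h).-1)).
  rewrite (dvdBlead _ _ aE); case.
  + by rewrite -(dvdBlead _ _ aE) -ltnS (leq_trans _ szgh) // ltnS ltn_add2l size_lead.
  + exists (c - g * (a%:P * 'X^((size h).-1))).
    by rewrite mulrBr ghE mulrBl !mulrA.
  + by left.
  + case=> d dE; right; exists (d + a%:P * 'X^((size h).-1)).
    by rewrite mulrDl -dE subrK.
Qed.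

Hypothesis factorA : forall c : A, c != 0 -> prime_factored c.

Lemma prime_factored_polyC (c : A) : c != 0 -> prime_factored c%:P.
Proof.
case/factorA=> u [ps [uU psP ->]]; exists u%:P, (map polyC ps).
rewrite polyC_unitE uU big_map polyCM rmorph_prod; split=> // _ /mapP[p pin ->].
by apply/prime_polyC/psP.
Qed.

Lemma factor_const_unit f (c : A) f' : irreducible_elt f -> (1 < size f)%N ->
  c != 0 -> f = c%:P * f' -> c%:P \is a GRing.unit.
Proof.
move=> [f0 _ fI] szf c0 fE; case: (fI _ _ fE) => // f'U.
by move: szf; rewrite fE mul_polyC size_scale // poly_unitE in f'U *; case/andP: f'U => /eqP->.
Qed.

Lemma mul_polyC_const (c : A) (a b : {poly A}) : c != 0 -> c%:P = a * b ->
  exists a' b', [/\ a = a'%:P, b = b'%:P, a' != 0 & b' != 0].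
Proof.
move=> c0 cE; have : a * b != 0 by rewrite -cE polyC_eq0.
rewrite mulf_eq0 negb_or => /andP[a0 b0].
have := size_polyC c; rewrite cE size_mul // c0 /=.
have := a0; have := b0; rewrite -!size_poly_gt0.
case sa: (size a) => [|[|ka]] //; case sb: (size b) => [|[|kb]] //= _ _;
  rewrite ?addnS ?addn0 //=.
have /size_poly1P[a' a'0 aE] : size a == 1%N by rewrite sa.
have /size_poly1P[b' b'0 bE] : size b == 1%N by rewrite sb.
by exists a', b'.
Qed.

(** An irreducible [f] of positive degree is primitive: a prime factor of [c]
    can never be a factor of [f], so all of them are absorbed by [T]. *)
Lemma dvd_of_dvd_scaled f g T (c : A) : irreducible_elt f -> (1 < size f)%N ->
  c != 0 -> c%:P * g = T * f -> divides f g.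
Proof.
move=> fI szf c0 cgE.
have [h1 [h2 [T' [f' [cE _ fE ->]]]]] := cancel_primes (prime_factored_polyC c0) cgE.
have [_ [e [_ h2E _ e0]]] := mul_polyC_const c0 cE.
have h2U : h2 \is a GRing.unit.
  by rewrite h2E; apply: factor_const_unit fI szf e0 _; rewrite -h2E fE.
by exists (T' * h2^-1); rewrite fE mulrA divrK.
Qed.

(** Pseudo-division gives a gcd [m] over the fraction field with
    [c * f = s * m]; moving the primes of [c] to the right-hand side turns this
    into a factorization of [f] itself.  Irreducibility then leaves two cases:
    [m] is constant, which is the claim, or [m] is associate to [f] up to a
    constant, so that [f] divides a multiple of [g] by a constant. *)
Lemma irreducible_bezout f g : irreducible_elt f -> (1 < size f)%N ->
  ~ divides f g -> exists u v (d : A), d != 0 /\ u * f + v * g = d%:P.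
Proof.
move=> fI szf fNg; have [f0 fU fP] := fI.
have m0 : gcdp f g != 0 by rewrite gcdp_eq0 negb_and f0.
have /Pdiv.Idomain.dvdpP[[c s] /= c0] := dvdp_gcdl f g.
have /Pdiv.Idomain.dvdpP[[c' t] /= c'0] := dvdp_gcdr f g.
have [[u v] /= /eqpP[[a b] /= /andP[a0 b0]]] := Bezoutp f g.
move: m0; set m := gcdp f g; rewrite -!mul_polyC => m0 uvE gE fE.
have [c1 [c2 [s' [m' [cE _ mE fE']]]]] := cancel_primes (prime_factored_polyC c0) fE.
have [_ [e [_ c2E _ e0]]] := mul_polyC_const c0 cE.
case: (fP _ _ fE') => [s'U|]; last first.
  rewrite poly_unitE => /andP[/size_poly1P[d d0 m'E] _].
  exists (a%:P * u), (a%:P * v), (b * (e * d)); split; first by rewrite !mulf_neq0.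
  by rewrite -!mulrA -mulrDr uvE mE c2E m'E !polyCM.
case: fNg; apply: (@dvd_of_dvd_scaled _ _ (t * (c2 * s'^-1)) c') => //.
transitivity (t * (c2 * m') * (s' * s'^-1)).
  by rewrite mulrV // mulr1 gE mE.
by rewrite fE'; ring.
Qed.

(** The constant [d] is a combination of [f] and [g], hence vanishes at all their
    common zeros; zeros are expressed as morphisms so that evaluation at a point
    of an affine space is an instance. *)
Lemma irreducible_eliminant f g : irreducible_elt f -> (1 < size f)%N ->
  ~ divides f g ->
  exists d : A, d != 0 /\
    forall (B : nzRingType) (ev : {rmorphism {poly A} -> B}),
      ev f = 0 -> ev g = 0 -> ev d%:P = 0.
Proof.
move=> fI szf fNg; have [u [v [d [d0 uvE]]]] := irreducible_bezout fI szf fNg.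
exists d; split=> // B ev evf evg.
by rewrite -uvE rmorphD !rmorphM evf evg !mulr0 addr0.
Qed.

(** Gauss's lemma.  In positive degree, a Bezout identity [u f + v g = d]
    multiplied by [h] shows that [f] divides [d * h], and [f] is primitive. *)
Lemma gauss_prime f : irreducible_elt f -> prime_elt f.
Proof.
move=> fI; have [f0 fU fP] := fI.
have [szf|] := ltnP 1 (size f).
  split=> // g h [S ghE].
  have [|fNg] := EM (divides f g); [by left|right].
  have [u [v [d [d0 uvE]]]] := irreducible_bezout fI szf fNg.
  have dhE : d%:P * h = (u * h + v * S) * f.
    transitivity (u * h * f + v * (g * h)); first by rewrite -uvE; ring.
    by rewrite ghE; ring.
  exact: dvd_of_dvd_scaled dhE.
(* In degree 0 the constant is already irreducible, hence prime, in [A]. *)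
move=> /size1_polyC; move: (f`_0) => c fE; move: fI; rewrite fE => cI.
have cI' := irreducible_polyC_inv cI; apply: prime_polyC.
by apply: irreducible_prime => //; apply: factorA; case: cI'.
Qed.

End Gauss.

(** * Polynomials in several variables form a factorial ring *)

Section RingIsomorphism.

Variables (A B : idomainType) (phi : {rmorphism A -> B}) (psi : {rmorphism B -> A}).
Hypotheses (phiK : cancel phi psi) (psiK : cancel psi phi).

Lemma iso_unitE a : (phi a \is a GRing.unit) = (a \is a GRing.unit).
Proof.
apply/idP/idP => [/(rmorph_unit psi)|/(rmorph_unit phi)//].
by rewrite phiK.
Qed.

Lemma iso_irreducible p : irreducible_elt p -> irreducible_elt (phi p).
Proof.
case=> p0 pU pI; split.
- by apply: contra_neq p0 => e; rewrite -[p]phiK e rmorph0.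
- by rewrite iso_unitE.
move=> g h /(congr1 psi); rewrite phiK rmorphM => /pI.
by rewrite -!(iso_unitE (psi _)) !psiK.
Qed.

Lemma iso_prime p : prime_elt (phi p) -> prime_elt p.
Proof.
have dvd_phi a b : divides a b <-> divides (phi a) (phi b).
  split=> -[c]; first by move=> ->; exists (phi c); rewrite rmorphM.
  by move/(congr1 psi); rewrite rmorphM !phiK => ->; exists (psi c).
case=> p0 pU pP; split.
- by apply: contra_neq p0 => ->; rewrite rmorph0.
- by rewrite -iso_unitE.
by move=> a b /dvd_phi; rewrite rmorphM => /pP[]/dvd_phi; [left|right].
Qed.

End RingIsomorphism.

(** All the identities below between substitutions reduce to this: a morphism is
    determined by its values on the constants and the variables. *)
Lemma mpoly_rmorph_ext n (R : comNzRingType) (S : comNzRingType)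
    (f g : {rmorphism {mpoly R[n]} -> S}) :
  (forall c, f c%:MP = g c%:MP) -> (forall i, f 'X_i = g 'X_i) -> f =1 g.
Proof.
move=> eqC eqX p; rewrite (mpolyE p) !rmorph_sum; apply: eq_bigr => m _.
rewrite -mul_mpolyC !rmorphM eqC mpolyXE_id !rmorph_prod; congr (_ * _).
by apply: eq_bigr => i _; rewrite !rmorphXn eqX.
Qed.

Section LastVariable.

Variables (n : nat) (F : fieldType).

Definition muni_inv (f : {poly {mpoly F[n]}}) : {mpoly F[n.+1]} :=
  (map_poly (@mwiden n F) f).['X_ord_max].

HB.instance Definition _ := GRing.RMorphism.copy muni_inv
  (horner_eval 'X_ord_max \o map_poly (@mwiden n F)).

Lemma muni_max : muni ('X_ord_max : {mpoly F[n.+1]}) = 'X.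
Proof.
rewrite /muni mmapX mmap1U; case: splitP => //= j /eqP.
by rewrite gtn_eqF.
Qed.

Lemma muni_lift (i : 'I_n) :
  muni ('X_(lift ord_max i) : {mpoly F[n.+1]}) = ('X_i)%:P.
Proof.
rewrite /muni mmapX mmap1U; case: splitP => /= j; rewrite /bump leqNgt ltn_ord.
  by move=> e; congr ('X__)%:P; apply: val_inj.
by rewrite ord1 /= addn0 add0n => /eqP; rewrite ltn_eqF.
Qed.

Lemma mwidenXU (i : 'I_n) : mwiden ('X_i : {mpoly F[n]}) = 'X_(lift ord_max i).
Proof.
rewrite mwidenX mnmwiden1; congr 'X_[U_(_)]; apply: val_inj => /=.
by rewrite /bump leqNgt ltn_ord.
Qed.

Lemma muniK : cancel (@muni n F) muni_inv.
Proof.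
apply: (@mpoly_rmorph_ext _ _ _ (muni_inv \o @muni n F) idfun) => [c|i] /=.
  by rewrite muniC /muni_inv map_polyC hornerC /= mwidenC.
have [j ->|->] := unliftP ord_max i.
  by rewrite muni_lift /muni_inv map_polyC hornerC /= mwidenXU.
by rewrite muni_max /muni_inv map_polyX hornerX.
Qed.

Lemma muni_invK : cancel muni_inv (@muni n F).
Proof.
have muni_widen (p : {mpoly F[n]}) : muni (mwiden p) = p%:P.
  move: p; apply: (@mpoly_rmorph_ext _ _ _ (@muni n F \o @mwiden n F) polyC) => [c|i] /=.
    by rewrite mwidenC muniC.
  by rewrite mwidenXU muni_lift.
elim/poly_ind => [|p c IH]; first by rewrite !rmorph0.
rewrite !rmorphD !rmorphM /= IH /muni_inv map_polyX map_polyC hornerX hornerC.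
by rewrite muni_max muni_widen.
Qed.

Definition extend (x : 'I_n -> F) (t : F) : 'I_n.+1 -> F :=
  fun i => if unlift ord_max i is Some j then x j else t.

Lemma meval_extend (p : {mpoly F[n.+1]}) x t :
  p.@[extend x t] = (map_poly (meval x) (muni p)).[t].
Proof.
move: p; apply: (@mpoly_rmorph_ext _ _ _ (meval (extend x t))
  (horner_eval t \o (map_poly (meval x) \o @muni n F))) => [c|i] /=.
  by rewrite muniC mevalC map_polyC /horner_eval hornerC /= mevalC.
rewrite mevalXU /horner_eval /extend; have [j ->|->] := unliftP ord_max i.
  by rewrite muni_lift map_polyC hornerC /= mevalXU.
by rewrite muni_max map_polyX hornerX.
Qed.

End LastVariable.

Section Factorial.

Variable F : fieldType.

Lemma mpoly_unitE n (p : {mpoly F[n]}) : (p \is a GRing.unit) = (msize p == 1%N).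
Proof.
apply/idP/idP => [pU|/msize_poly1P[c c0 ->]]; last first.
  by apply: rmorph_unit; rewrite unitfE.
have p0 : p != 0 by apply: contraTneq pU => ->; rewrite unitr0.
have q0 : p^-1 != 0 by rewrite invr_eq0.
have := congr1 (fun p => msize p) (mulrV pU); rewrite msizeM // msize1.
rewrite -!msize_poly_eq0 in p0 q0.
by move: p0 q0; case: (mmeasure mdeg p) => [|[|k]] //; case: (mmeasure mdeg _) => // j; rewrite addnS.
Qed.

Lemma mpoly0_unit (p : {mpoly F[0]}) : p != 0 -> p \is a GRing.unit.
Proof.
move=> p0; rewrite mpoly_unitE eqn_leq lt0n msize_poly_eq0 p0 andbT.
by rewrite msizeE big_seq; apply/bigmax_leqP_seq => m _ _; rewrite mdegE big_ord0.
Qed.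

(** Over a field the degree is additive and the units are the polynomials of
    degree 0, so splitting into non-units strictly lowers the degree. *)
Lemma irreducible_factorization n (p : {mpoly F[n]}) : p != 0 ->
  exists (u : {mpoly F[n]}) (fs : seq {mpoly F[n]}),
    [/\ u \is a GRing.unit, forall f, f \in fs -> irreducible_elt f
      & p = u * \prod_(f <- fs) f].
Proof.
have [k] := ubnP (msize p); elim: k p => // k IH p ltpk p0.
have [pU|pU] := boolP (p \is a GRing.unit).
  by exists p, [::]; rewrite big_nil mulr1.
have [pI|pNI] := EM (irreducible_elt p).
  exists 1, [:: p]; rewrite big_seq1 mul1r unitr1; split=> // f.
  by rewrite inE => /eqP->.
have [g [h [pE gU hU]]] : exists g h, [/\ p = g * h,
    g \isn't a GRing.unit & h \isn't a GRing.unit].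
  apply: contra_notP pNI => noGH; split=> // g h pE.
  have [|gU] := boolP (g \is a GRing.unit); first by left.
  have [|hU] := boolP (h \is a GRing.unit); first by right.
  by case: noGH; exists g, h.
have [g0 h0] : g != 0 /\ h != 0 by apply/andP; rewrite -negb_or -mulf_eq0 -pE.
have szp : msize p = (msize g + msize h).-1 by rewrite pE msizeM.
have [ltg lth] : (msize g < k)%N /\ (msize h < k)%N.
  rewrite szp in ltpk; move: ltpk gU hU g0 h0.
  rewrite !mpoly_unitE -!msize_poly_eq0.
  by move: (mmeasure _ g) (mmeasure _ h) => a b; lia.
have [u [fs [uU fsI gE]]] := IH g ltg g0.
have [v [fs' [vU fsI' hE]]] := IH h lth h0.
exists (u * v), (fs ++ fs'); rewrite unitrM uU vU big_cat pE gE hE.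
split=> //=; last by ring.
by move=> f; rewrite mem_cat => /orP[/fsI|/fsI'].
Qed.

(** Induction on the number of variables, viewing a polynomial as one in the last
    variable with coefficients in the others and applying Gauss's lemma. *)
Theorem mpoly_factorial n (p : {mpoly F[n]}) : p != 0 -> prime_factored p.
Proof.
elim: n p => [|n IH] p p0; first by exists p, [::]; rewrite mpoly0_unit // big_nil mulr1.
have [u [fs [uU fsI pE]]] := irreducible_factorization p0.
exists u, fs; split=> // f /fsI fI.
apply: (iso_prime (@muniK n F)).
by apply: gauss_prime => //; apply: (iso_irreducible (@muniK n F) (@muni_invK n F)).
Qed.

End Factorial.

(** * The Nullstellensatz for an irreducible hypersurface *)

Section Nullstellensatz.

Variable F : closedFieldType.

(** Choose the first coordinates off the zeros of the leading coefficient, then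
    the last one off the finitely many roots that remain. *)
Lemma mpoly_nonvanishing n (p : {mpoly F[n]}) : p != 0 -> exists x, p.@[x] != 0.
Proof.
elim: n p => [|n IH] p p0.
  exists (fun=> 0); have := rmorph_unit (meval (fun=> 0)) (mpoly0_unit p0).
  by rewrite unitfE.
have up0 : muni p != 0.
  by apply: contra_neq p0 => e; rewrite -[p]muniK e rmorph0.
have [x xP] : exists x, (lead_coef (muni p)).@[x] != 0 by apply: IH; rewrite lead_coef_eq0.
have /closed_nonrootP[t tP] : map_poly (meval x) (muni p) != 0.
  by apply: contra_neq xP => e; rewrite lead_coefE -coef_map e coef0.
by exists (extend x t); rewrite meval_extend.
Qed.

(** If [f] involves the last variable and does not divide [g], there is [d] in the
    other variables that vanishes at all common zeros of [f] and [g].  Over a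
    point where neither [d] nor the leading coefficient of [f] vanishes, [f] has a
    root in the last variable, and [g] is nonzero there.  If [f] does not involve
    the last variable, the coefficients of [g] vanish on the zero set of [f] and
    induction applies to each of them. *)
Theorem nullstellensatz_irreducible n (f g : {mpoly F[n]}) : irreducible_elt f ->
  (forall x, f.@[x] = 0 -> g.@[x] = 0) -> divides f g.
Proof.
elim: n f g => [|n IH] f g fI fg; first by case: fI => /mpoly0_unit->.
have ufI : irreducible_elt (muni f) := iso_irreducible (@muniK n F) (@muni_invK n F) fI.
have dvd_muni : divides (muni f) (muni g) -> divides f g.
  by case=> c e; exists (muni_inv c); rewrite -[g]muniK e rmorphM /= muniK.
apply: dvd_muni; have [szf|] := ltnP 1 (size (muni f)); last first.
 move=> /size1_polyC; move: (_`_0) => a ufE; rewrite ufE.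
  have aI : irreducible_elt a by apply: irreducible_polyC_inv; rewrite -ufE.
  have /choice[c cE] i : exists c, (muni g)`_i = c * a.
    apply: IH aI _ => x ax; rewrite -coef_map.
    suff -> : map_poly (meval x) (muni g) = 0 by rewrite coef0.
    apply: contrapT => /eqP/closed_nonrootP[t]; apply/negP; rewrite negbK.
    rewrite rootE -meval_extend fg ?eqxx //.
    by rewrite meval_extend ufE map_polyC hornerC /= ax.
  exists (\poly_(i < size (muni g)) c i); apply/polyP => i.
  rewrite coefMC coef_poly; case: ltnP => [_|ge]; first exact: cE.
  by rewrite mul0r nth_default.
apply: contrapT => fNg.
have [d [d0 dP]] := irreducible_eliminant (@mpoly_factorial F n) ufI szf fNg.
have uf0 : muni f != 0 by case: ufI.
have /mpoly_nonvanishing[x] : d * lead_coef (muni f) != 0.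
  by rewrite mulf_neq0 ?lead_coef_eq0.
rewrite mevalM mulf_eq0 negb_or => /andP[dx lx].
have /closed_rootP[t] : size (map_poly (meval x) (muni f)) != 1%N.
  by rewrite size_map_poly_id0 // neq_ltn szf orbT.
rewrite rootE -meval_extend => /eqP ft.
pose ev : {rmorphism {poly {mpoly F[n]}} -> F} :=
  horner_eval t \o map_poly (meval x).
have ev_muni h : ev (muni h) = h.@[extend x t] by rewrite meval_extend.
have : ev d%:P = 0 by apply: dP; rewrite ev_muni // fg.
rewrite /ev /= /horner_eval map_polyC hornerC.
by move=> /eqP; rewrite (negPf dx).
Qed.

End Nullstellensatz.

(** * Factoring a polynomial by equations of its zero set *)

Section Decomposition.

Variables (F : closedFieldType) (n : nat).
Implicit Types (p w : {mpoly F[n]}) (ws us : seq {mpoly F[n]}).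

Lemma unit_prod_of_dvd (fs ws : seq {mpoly F[n]}) :
  (forall w, w \in ws -> irreducible_elt w) ->
  (forall f, f \in fs -> irreducible_elt f /\ divides f (\prod_(w <- ws) w)) ->
  exists v us, [/\ v \is a GRing.unit, {subset us <= ws}
                & \prod_(f <- fs) f = v * \prod_(w <- us) w].
Proof.
move=> wsI; elim: fs => [|f fs IH] fsP.
  by exists 1, [::]; rewrite !big_nil mulr1 unitr1.
have [f' f'in|v [us [vU us_ws fsE]]] := IH.
  by apply: fsP; rewrite in_cons f'in orbT.
have [fI fdvd] := fsP f (mem_head _ _).
have fP : prime_elt f.
  by apply: irreducible_prime (fI); apply: mpoly_factorial; case: fI.
have [w win [d wE]] := prime_dvd_prod fP fdvd.
have dU : d \is a GRing.unit.
  have [_ _ wP] := wsI w win; case: (wP _ _ wE) => // fU.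
  by case: fI => _; rewrite fU.
exists (v / d), (w :: us); split.
- by rewrite unitrM vU unitrV.
- by move=> w'; rewrite in_cons => /orP[/eqP->|/us_ws].
rewrite !big_cons fsE wE.
transitivity (v * (d^-1 * d) * f * \prod_(w <- us) w); last by ring.
by rewrite mulVr //; ring.
Qed.

(** Each irreducible factor [f] of [p] divides the product of [ws] by the
    Nullstellensatz, hence divides, and so is associate to, a member of [ws]. *)
Lemma prod_of_zero_set p ws : p != 0 ->
  (forall w, w \in ws -> irreducible_elt w) ->
  (forall x, p.@[x] = 0 -> exists2 w, w \in ws & w.@[x] = 0) ->
  exists c us, [/\ c != 0, {subset us <= ws} & p = c *: \prod_(w <- us) w].
Proof.
move=> p0 wsI p_ws; have [u [fs [uU fsI pE]]] := irreducible_factorization p0.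
have [f fin|v [us [vU us_ws fsE]]] := @unit_prod_of_dvd fs ws wsI.
  split; first exact: fsI.
  apply: nullstellensatz_irreducible (fsI _ fin) _ => x fx.
  have [|w win wx] := p_ws x.
    by rewrite pE rmorphM rmorph_prod /= (big_rem f) //= fx mul0r mulr0.
  by rewrite rmorph_prod /= (big_rem w) //= wx mul0r.
have : u * v \is a GRing.unit by rewrite unitrM uU.
rewrite mpoly_unitE => /msize_poly1P[c c0 uvE].
by exists c, us; split=> //; rewrite pE fsE mulrA uvE mul_mpolyC.
Qed.

End Decomposition.

(** * Irreducibility of the equations of the basic varieties *)

Section Irreducibility.

Variable F : fieldType.

Lemma irreducible_degree1 n (p : {mpoly F[n]}) x y :
  (msize p <= 2)%N -> p.@[x] != p.@[y] -> irreducible_elt p.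
Proof.
move=> szp pxy; have szp2 : msize p = 2%N.
  apply/eqP; rewrite eqn_leq szp ltnNge; apply: contraNN pxy => /msize1_polyC->.
  by rewrite !mevalC.
have p0 : p != 0 by rewrite -msize_poly_eq0 szp2.
split; rewrite ?mpoly_unitE ?szp2 // => g h pE.
have [g0 h0] : g != 0 /\ h != 0 by apply/andP; rewrite -negb_or -mulf_eq0 -pE.
have : msize p = (msize g + msize h).-1 by rewrite pE msizeM.
rewrite !mpoly_unitE szp2; rewrite -!msize_poly_eq0 in g0 h0.
move: (mmeasure _ g) (mmeasure _ h) g0 h0 => a b a0 b0 ab.
by apply/orP; lia.
Qed.

Section Rename.

Variables (k n : nat) (sigma : 'I_k -> 'I_n).

Definition rename : {mpoly F[k]} -> {mpoly F[n]} :=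
  mmap (@mpolyC n F) (fun t => 'X_(sigma t)).

HB.instance Definition _ := GRing.RMorphism.copy rename
  (mmap (@mpolyC n F) (fun t => 'X_(sigma t))).

Lemma renameC c : rename c%:MP = c%:MP. Proof. exact: mmapC. Qed.

Lemma renameX t : rename 'X_t = 'X_(sigma t).
Proof. by rewrite /rename mmapX mmap1U. Qed.

Lemma meval_rename (p : {mpoly F[k]}) x :
  (rename p).@[x] = p.@[fun t => x (sigma t)].
Proof.
move: p; apply: (@mpoly_rmorph_ext _ _ _ (meval x \o rename)) => [c|t] /=.
  by rewrite renameC !mevalC.
by rewrite renameX !mevalXU.
Qed.

Hypothesis sigma_inj : injective sigma.

(** The coordinates outside the image of [sigma] are sent to 0, which makes
    [restrict] a retraction of [rename sigma]. *)
Definition restrict_var (i : 'I_n) : {mpoly F[k]} :=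
  if [pick t | sigma t == i] is Some t then 'X_t else 0.

Definition restrict : {mpoly F[n]} -> {mpoly F[k]} :=
  mmap (@mpolyC k F) restrict_var.

HB.instance Definition _ := GRing.RMorphism.copy restrict
  (mmap (@mpolyC k F) restrict_var).

(** Multiplying the coordinates outside the image of [sigma] by a parameter
    ['X] interpolates between [rename sigma \o restrict], at 0, and the identity,
    at 1; a polynomial with constant dilation only involves coordinates in the
    image. *)
Definition dilate_var (i : 'I_n) : {poly {mpoly F[n]}} :=
  if i \in codom sigma then ('X_i)%:P else ('X_i)%:P * 'X.

Definition dilate : {mpoly F[n]} -> {poly {mpoly F[n]}} :=
  mmap (polyC \o @mpolyC n F) dilate_var.

HB.instance Definition _ := GRing.RMorphism.copy dilate
  (mmap (polyC \o @mpolyC n F) dilate_var).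

Lemma restrictC c : restrict c%:MP = c%:MP. Proof. exact: mmapC. Qed.

Lemma restrictX t : restrict 'X_(sigma t) = 'X_t.
Proof.
rewrite /restrict mmapX mmap1U /restrict_var; case: pickP => [s /eqP/sigma_inj->//|].
by move/(_ t); rewrite eqxx.
Qed.

Lemma restrictX0 i : i \notin codom sigma -> restrict 'X_i = 0.
Proof.
rewrite /restrict mmapX mmap1U /restrict_var; case: pickP => [s /eqP<-|//].
by rewrite codom_f.
Qed.

Lemma dilateC c : dilate c%:MP = (c%:MP)%:P. Proof. exact: mmapC. Qed.

Lemma dilateX i :
  dilate 'X_i = if i \in codom sigma then ('X_i)%:P else ('X_i)%:P * 'X.
Proof. by rewrite /dilate mmapX mmap1U. Qed.

Lemma renameK : cancel rename restrict.
Proof.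
apply: (@mpoly_rmorph_ext _ _ _ (restrict \o rename) idfun) => [c|t] /=.
  by rewrite renameC restrictC.
by rewrite renameX restrictX.
Qed.

Lemma dilate_rename (p : {mpoly F[k]}) : dilate (rename p) = (rename p)%:P.
Proof.
move: p; apply: (@mpoly_rmorph_ext _ _ _ (dilate \o rename) (polyC \o rename)).
  by move=> c /=; rewrite renameC dilateC.
by move=> t /=; rewrite renameX dilateX codom_f.
Qed.

Lemma dilate_at1 (p : {mpoly F[n]}) : (dilate p).[1] = p.
Proof.
move: p; apply: (@mpoly_rmorph_ext _ _ _ (horner_eval 1 \o dilate) idfun) => [c|i] /=.
  by rewrite dilateC /horner_eval hornerC.
rewrite dilateX /horner_eval; case: ifP => _; rewrite ?hornerC //.
by rewrite hornerM hornerX hornerC mulr1.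
Qed.

Lemma dilate_at0 (p : {mpoly F[n]}) : (dilate p).[0] = rename (restrict p).
Proof.
move: p; apply: (@mpoly_rmorph_ext _ _ _ (horner_eval 0 \o dilate)
  (rename \o restrict)) => [c|i] /=.
  by rewrite dilateC /horner_eval hornerC restrictC renameC.
rewrite dilateX /horner_eval; case: ifPn => [/codomP[t ->]|iN].
  by rewrite hornerC restrictX renameX.
by rewrite hornerM hornerX mulr0 restrictX0 // rmorph0.
Qed.

(** The dilation of [rename q] is constant in the parameter, hence so are those of
    its factors.  The factors thus come from a factorization of [q]. *)
Lemma irreducible_rename (q : {mpoly F[k]}) :
  irreducible_elt q -> irreducible_elt (rename q).
Proof.
case=> q0 qU qP.
have rq0 : rename q != 0 by apply: contra_neq q0 => e; rewrite -[q]renameK e rmorph0.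
split=> //.
  by apply: contraNN qU => /(rmorph_unit restrict); rewrite /= renameK.
move=> g h rqE.
have dE : (rename q)%:P = dilate g * dilate h.
  by rewrite -dilate_rename rqE rmorphM.
have [a [b [gE hE _ _]]] := mul_polyC_const rq0 dE.
have gK : rename (restrict g) = g.
  by rewrite -dilate_at0 -[RHS]dilate_at1 gE !hornerC.
have hK : rename (restrict h) = h.
  by rewrite -dilate_at0 -[RHS]dilate_at1 hE !hornerC.
have : q = restrict g * restrict h by rewrite -rmorphM -rqE /= renameK.
by case/qP => /(rmorph_unit rename) /=; rewrite ?gK ?hK; [left|right].
Qed.

End Rename.

End Irreducibility.

(** * Accuracy of products *)

(** By induction: if [P] is the product of the remaining factors, then
    [(1 + d) P - 1 = (1 + d) (P - 1) + d] and [`|1 + d| <= 2]. *)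
Lemma norm_prod_error (C : numDomainType) (e : C) (ds : seq C) :
  0 <= e <= 1 -> (forall d, d \in ds -> `|d| <= e) ->
  `|\prod_(d <- ds) (1 + d) - 1| <= (2 ^+ size ds - 1) * e.
Proof.
case/andP=> e0 e1; elim: ds => [|d ds IH] ds_e.
  by rewrite big_nil subrr normr0 mul0r.
have de := ds_e d (mem_head _ _).
have {}IH : `|\prod_(d <- ds) (1 + d) - 1| <= (2 ^+ size ds - 1) * e.
  by apply: IH => d' d'in; apply: ds_e; rewrite in_cons d'in orbT.
rewrite big_cons; set P := \prod_(_ <- _) _ in IH *.
have -> : (1 + d) * P - 1 = (1 + d) * (P - 1) + d by ring.
have -> : (2 ^+ size (d :: ds) - 1) * e = 2 * ((2 ^+ size ds - 1) * e) + e.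
  by rewrite /= exprS; ring.
apply: le_trans (ler_normD _ _) _; apply: lerD => //.
rewrite normrM; apply: ler_pM => //.
apply: le_trans (ler_normD _ _) _; rewrite normr1 -[2]/(1 + 1) lerD2l.
exact: le_trans de e1.
Qed.

Section Algorithms.

Local Open Scope complex_scope.

Variables (R : realType) (J : Type) (ar : J -> nat).
Variable q : forall j : J, {mpoly R[i][ar j]}.

Lemma push_max m (v : 'I_m -> R[i]) z : push v z ord_max = z.
Proof. by rewrite /push unlift_none. Qed.

Lemma push_lift m (v : 'I_m -> R[i]) z i : push v z (lift ord_max i) = v i.
Proof. by rewrite /push liftK. Qed.

(** Such a polynomial is computed with relative error at most epsilon at every
    input, because the operation is exact before its result is rounded. *)
Definition one_op n (w : {mpoly R[i][n]}) : Prop :=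
  exists (o : operation R J) (args : 'I_(op_arity ar o) -> bool * 'I_n),
    forall x : 'I_n -> R[i],
      (op_poly q o).@[fun t => arg_value x (args t)] = w.@[x].

(** A bound on the relative error that composes: the computed value is the exact
    one times [K] factors [1 + d].  The number [K] depends neither on the input nor
    on the bound [e] on the errors, and taking [e = 0] gives exactness. *)
Definition computes m (a : algorithm R ar m) (K : nat)
    (z : ('I_m -> R[i]) -> R[i]) : Prop :=
  forall (e : R) (v : 'I_m -> R[i]) (delta : node a -> R[i]),
    (forall d, `|delta d| <= e%:C) ->
    exists ds : seq R[i],
      [/\ size ds = K, forall d, d \in ds -> `|d| <= e%:C
        & p_comp q v delta = z v * \prod_(d <- ds) (1 + d)].

(** Stated for a partial computation with accumulator [r] and sources at [emb], so
    that the induction can append to a computation that has already begun. *)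
Lemma product_algorithm n (ws : seq {mpoly R[i][n]}) :
  (forall w, w \in ws -> one_op w) ->
  forall m (emb : 'I_n -> 'I_m) (r : 'I_m),
  exists (a : algorithm R ar m) (K : nat),
    computes a K (fun v => v r * \prod_(w <- ws) w.@[fun i => v (emb i)]).
Proof.
elim: ws => [|w ws IH] ws1 m emb r.
  exists (Output R ar r), 0%N => e v delta _; exists [::].
  by split=> //; rewrite !big_nil !mulr1.
have [o [args wE]] := ws1 w (mem_head _ _).
have ws1' w' : w' \in ws -> one_op w'.
  by move=> w'in; apply: ws1; rewrite in_cons w'in orbT.
have [a [K aP]] := IH ws1' m.+2
  (fun i => lift ord_max (lift ord_max (emb i))) ord_max.
exists (@Compute R J ar m o (fun t => ((args t).1, emb (args t).2))
  (@Compute R J ar m.+1 (OpMul R J)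
    (fun t => (false, if t == ord0 then lift ord_max r else ord_max)) a)), K.+2.
move=> e v delta dP /=.
set z1 := _ * (1 + delta None); set z2 := _ * (1 + delta (Some None)).
have [ds [szds dsP ->]] := aP e (push (push v z1) z2)
  (fun d => delta (Some (Some d))) (fun d => dP _).
exists (delta None :: delta (Some None) :: ds); split; first by rewrite /= szds.
  move=> d; rewrite !in_cons => /orP[/eqP->//|/orP[/eqP->//|]].
  exact: dsP.
rewrite push_max !big_cons.
under eq_bigr => w' _.
  rewrite (@meval_eq _ _ _ (fun i => v (emb i))); last first.
    by move=> i; rewrite !push_lift.
  over.
have -> : z2 = v r * z1 * (1 + delta (Some None)).
  by rewrite /z2 mevalM !mevalXU /arg_value /= push_lift push_max.
have -> : z1 = w.@[fun i => v (emb i)] * (1 + delta None) by rewrite /z1 -wE.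
by ring.
Qed.

(** With [K] error factors the relative error is at most [(2 ^ K - 1) eps], so
    [eps = eta / 2 ^ K] suffices. *)
Lemma computes_evaluable n (a : algorithm R ar n) K (p : {mpoly R[i][n]}) :
  computes a K (fun x => p.@[x]) -> accurately_evaluable q p setT.
Proof.
move=> aP; exists a; split=> [x|eta /andP[eta0 eta1]].
  have [|ds [_ ds0 ->]] := aP 0 x (fun=> 0); first by move=> d; rewrite normr0.
  rewrite big_seq big1 ?mulr1 // => d /ds0.
  by rewrite normr_le0 => /eqP->; rewrite addr0.
have K0 : 0 < (2 : R) ^+ K by rewrite exprn_gt0.
have K1 : 1 <= (2 : R) ^+ K by rewrite exprn_ege1 // ler1n.
have eps0 : 0 < eta / 2 ^+ K by rewrite divr_gt0.
have eps1 : eta / 2 ^+ K < 1 by rewrite ltr_pdivrMr // mul1r (lt_le_trans eta1).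
exists (eta / 2 ^+ K); first by rewrite eps0.
move=> x delta _ dP; have [ds [szds dsP ->]] := aP _ x delta dP.
set z := p.@[x]; rewrite -[X in _ - X]mulr1 -mulrBr normrM mulrC.
apply: ler_wpM2r => //; apply: le_trans (norm_prod_error _ dsP) _.
  by rewrite -(rmorph0 (real_complex R)) -(rmorph1 (real_complex R)) !lecR !ltW.
rewrite szds; have -> : (2 ^+ K - 1 : R[i]) = (2 ^+ K - 1)%:C.
  by rewrite rmorphB rmorphXn rmorph1 rmorph_nat.
rewrite -rmorphM lecR mulrCA ger_pMr // ler_pdivrMr // mul1r.
by rewrite lerBlDr lerDl.
Qed.

Lemma scaled_product_evaluable n c (w : {mpoly R[i][n]}) ws :
  (forall w', w' \in w :: ws -> one_op w') ->
  accurately_evaluable q (c *: \prod_(w' <- w :: ws) w') setT.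
Proof.
move=> ws1; have [o [args wE]] := ws1 w (mem_head _ _).
have [|a [K aP]] := @product_algorithm n ws _ n.+2
  (fun i => lift ord_max (lift ord_max i)) ord_max.
  by move=> w' w'in; apply: ws1; rewrite in_cons w'in orbT.
apply: (@computes_evaluable _ (@Compute R J ar n o args
  (@Compute R J ar n.+1 (OpScale J c) (fun=> (false, ord_max)) a)) K.+2).
move=> e x delta dP /=.
set z1 := _ * (1 + delta None); set z2 := _ * (1 + delta (Some None)).
have [ds [szds dsP ->]] := aP e (push (push x z1) z2)
  (fun d => delta (Some (Some d))) (fun d => dP _).
exists (delta None :: delta (Some None) :: ds); split; first by rewrite /= szds.
  move=> d; rewrite !in_cons => /orP[/eqP->//|/orP[/eqP->//|]].
  exact: dsP.
rewrite push_max !big_cons mevalZ mevalM rmorph_prod /=.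
under eq_bigr => w' _.
  rewrite (@meval_eq _ _ _ x); last by move=> i; rewrite !push_lift.
  over.
have -> : z2 = c * z1 * (1 + delta (Some None)).
  by rewrite /z2 mevalZ mevalXU /arg_value /= push_max.
have -> : z1 = w.@[x] * (1 + delta None) by rewrite /z1 -wE.
by ring.
Qed.

(** [x_i - x_i] is computed as an exact 0, so a black box that does not vanish at
    the origin provides a nonzero constant. *)
Lemma constant_evaluable n (i : 'I_n) (j : J) c :
  (q j).@[fun=> 0] != 0 -> accurately_evaluable q (c%:MP : {mpoly R[i][n]}) setT.
Proof.
move=> qj0.
apply: (@computes_evaluable _ (@Compute R J ar n (OpSub R J) (fun=> (false, i))
  (@Compute R J ar n.+1 (OpBox R j) (fun=> (false, ord_max))
  (@Compute R J ar n.+2 (OpScale J (c / (q j).@[fun=> 0]))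
    (fun=> (false, ord_max)) (Output R ar ord_max)))) 2).
move=> e x delta dP /=; rewrite mevalB !mevalXU subrr mul0r push_max.
exists [:: delta (Some None); delta (Some (Some None))]; split=> //.
  by move=> d; rewrite !inE => /orP[]/eqP->.
rewrite mevalZ mevalXU /arg_value /= !push_max mevalC !big_cons big_nil.
by field.
Qed.

Lemma basic_variety_one_op n (W : set ('I_n -> R[i])) :
  (forall j, mpoly_irreducible (q j)) -> basic_variety q W ->
  exists w, [/\ irreducible_elt w, one_op w & W = zero_set w].
Proof.
move=> qI.
have X1 (i : 'I_n) : (msize ('X_i : {mpoly R[i][n]}) <= 2)%N by rewrite msizeX mdeg1.
pose pt i : 'I_n -> R[i] := fun k => (k == i)%:R.
case=> [i|i j ij|i j ij|j sigma sigma_inj].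
- exists 'X_i; split.
  + apply: (@irreducible_degree1 _ _ _ (pt i) (fun=> 0)) => //.
    by rewrite !mevalXU /pt eqxx oner_neq0.
  + exists (OpScale J 1), (fun=> (false, i)) => x.
    by rewrite /= scale1r !mevalXU.
  + by apply/seteqP; split=> x; rewrite /zero_set /= mevalXU.
- exists ('X_i + 'X_j); split.
  + apply: (@irreducible_degree1 _ _ _ (pt i) (fun=> 0)).
      by apply: leq_trans (msizeD_le _ _) _; rewrite geq_max !X1.
    by rewrite !mevalD !mevalXU /pt eqxx (eq_sym j) (negPf ij) !addr0 oner_neq0.
  + exists (OpAdd R J), (fun t => (false, if t == ord0 then i else j)) => x.
    by rewrite /= !mevalD !mevalXU.
  + by apply/seteqP; split=> x; rewrite /zero_set /= mevalD !mevalXU.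
- exists ('X_i - 'X_j); split.
  + apply: (@irreducible_degree1 _ _ _ (pt i) (fun=> 0)).
      by apply: leq_trans (msizeD_le _ _) _; rewrite msizeN geq_max !X1.
    by rewrite !mevalB !mevalXU /pt eqxx (eq_sym j) (negPf ij) !subr0 oner_neq0.
  + exists (OpSub R J), (fun t => (false, if t == ord0 then i else j)) => x.
    by rewrite /= !mevalB !mevalXU.
  + by apply/seteqP; split=> x; rewrite /zero_set /= mevalB !mevalXU.
- exists (rename sigma (q j)); split.
  + by apply: irreducible_rename => //; apply: qI.
  + by exists (OpBox R j), (fun t => (false, sigma t)) => x; rewrite meval_rename.
  + by apply/seteqP; split=> x; rewrite /zero_set /= meval_rename.
Qed.

End Algorithms.

(** * Accurate evaluation *)

Theorem theorem5p27 (R : realType) (J : Type) (ar : J -> nat)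
    (q : forall j : J, {mpoly R[i][ar j]})
    (q_irr : forall j : J, mpoly_irreducible (q j))
    (n : nat) (n_gt0 : (0 < n)%N) (p : {mpoly R[i][n]})
    (Vp : finite_union_of_intersections q (zero_set p)) :
  accurately_evaluable q p setT.
Proof.
pose i0 := Ordinal n_gt0.
have [->|p0] := eqVneq p 0.
  have [w [_ w1 _]] := basic_variety_one_op q_irr (basic_Z q i0).
  rewrite -[0](scale0r (\prod_(w' <- [:: w]) w')).
  by apply: scaled_product_evaluable => w'; rewrite inE => /eqP->.
have [N [F [N0 FW VpE]]] := Vp.
have FP k : exists w, [/\ irreducible_elt w, one_op q w &
    forall x, (\bigcap_(W in F k) W)%classic x -> w.@[x] = 0].
  (* An empty family would make [p] vanish everywhere. *)
  have [[W FkW]|FkN] := EM (exists W, F k W); last first.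
    have [x] := mpoly_nonvanishing p0; case/eqP.
    suff : zero_set p x by [].
    by rewrite VpE; exists k => // W FkW; case: FkN; exists W.
  have [w [wI w1 WE]] := basic_variety_one_op q_irr (FW k W FkW).
  by exists w; split=> // x /(_ W FkW); rewrite WE.
have {FP}[w wP] := choice FP.
have [_ /codomP[k ->]|x px|c [us [c0 us_w pE]]] := @prod_of_zero_set _ _ p (codom w) p0.
- by case: (wP k).
- have : zero_set p x by [].
  rewrite VpE => -[k _ Fkx]; exists (w k); first exact: codom_f.
  by case: (wP k) => _ _; apply.
have us1 u : u \in us -> one_op q u by move=> /us_w/codomP[k ->]; case: (wP k).
case: us us1 pE {us_w} => [_|u us us1 ->]; last exact: scaled_product_evaluable.
rewrite big_nil -mul_mpolyC mulr1 => pE; rewrite pE.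
(* If every member of the family contained the origin, so would the zero set of
   the nonzero constant [p]. *)
have [W FW0 W0] : exists2 W, F (Ordinal N0) W & ~ W (fun=> 0).
  apply: contrapT => noW.
  suff : zero_set p (fun=> 0) by rewrite /zero_set /= pE mevalC; apply/eqP.
  rewrite VpE; exists (Ordinal N0) => // W FW0.
  by apply: contrapT => W0; apply: noW; exists W.
case: (FW _ _ FW0) W0 => [i|i j _|i j _|j sigma _] W0.
- by case: W0.
- by case: W0; rewrite /= addr0.
- by case: W0; rewrite /= subr0.
by apply: (@constant_evaluable _ _ _ _ _ i0 j); apply/eqP.
Qed.
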